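(* Let $(A,\prec,\succ)$ be a dendriform $H$-pseudoalgebra. Define $$x*y=x\succ y-((12)\otimes_H\mathrm{id})(y\prec x),\qquad x,y\in A.$$ Then $(A,* )$ is a pre-Lie $H$-pseudoalgebra.
   Context: $k$ is an algebraically closed field of characteristic zero and $H$ is a cocommutative Hopf algebra over $k$ with comultiplication $\Delta$; $\otimes=\otimes_k$. For $n\ge 1$, $H^{\otimes n}$ is a right $H$-module via the iterated comultiplication, and for a left $H$-module $M$ the space $H^{\otimes n}\otimes_H M$ is a left $H^{\otimes n}$-module by left multiplication. A linear map $*: L\otimes M\to H^{\otimes 2}\otimes_H N$ is $H^{\otimes 2}$-linear if $fa*gb=((f\otimes g)\otimes_H 1)(a*b)$ for all $f,g\in H$. Such maps are composed as follows: if $x*y=\sum_i (f_i\otimes g_i)\otimes_H e_i$ and $F\in H^{\otimes 2}$, then $$(F\otimes_H x)*y=\sum_i (F\otimes 1)(\Delta\otimes \mathrm{id})(f_i\otimes g_i)\otimes_H e_i,\qquad x*(F\otimes_H y)=\sum_i (1\otimes F)(\mathrm{id}\otimes\Delta)(f_i\otimes g_i)\otimes_H e_i,$$ elements of $H^{\otimes 3}\otimes_H N$. The transposition $(12)$ exchanges the first two tensor factors of $H^{\otimes 2}$ or $H^{\otimes 3}$, and acts on $H^{\otimes n}\otimes_H N$ as $(12)\otimes_H\mathrm{id}$ (well defined since $H$ is cocommutative). A dendriform $H$-pseudoalgebra $(A,\prec,\succ)$ is a left $H$-module $A$ with $H^{\otimes 2}$-linear maps $\prec,\succ:A\otimes A\to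 H^{\otimes 2}\otimes_H A$ such that for all $x,y,z\in A$: $(x\prec y)\prec z=x\prec(y\prec z+y\succ z)$, $(x\succ y)\prec z=x\succ(y\prec z)$, $(x\prec y+x\succ y)\succ z=x\succ(y\succ z)$. A pre-Lie $H$-pseudoalgebra is a left $H$-module $A$ with an $H^{\otimes 2}$-linear map $*:A\otimes A\to H^{\otimes 2}\otimes_H A$ such that $(x*y)*z-x*(y*z)=((12)\otimes_H\mathrm{id})((y*x)*z-y*(x*z))$ for all $x,y,z\in A$. *)

(* Defs.v *)
From HB Require Import structures.
From mathcomp Require Import all_boot all_algebra generic_quotient ring_quotient.
From mathcomp.multinomials Require Import freeg.
From mathcomp Require Import boolp classical_sets.

Set Implicit Arguments.
Unset Strict Implicit.
Unset Printing Implicit Defensive.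

Import GRing.Theory.
Local Open Scope ring_scope.
Local Open Scope quotient_scope.

(* The tensor product over R of V and W: the free abelian group on V * W
   modulo the subgroup generated by the usual relations. The right action [ra]
   of R on V and the left action [la] of R on W are plain functions, so that a
   ring can be regarded as a right module over another one without an alias. *)
Section Tensor.
Variables (R : Type) (V W : zmodType) (ra : V -> R -> V) (la : R -> W -> W).

Local Notation F := {freeg (V * W)%type / int}.

Inductive tens_null : F -> Prop :=
| TensNull0 : tens_null 0
| TensNullB x y : tens_null x -> tens_null y -> tens_null (x - y)
| TensNullDl v v' w :
    tens_null (<< (v + v', w) >> - (<< (v, w) >> + << (v', w) >>))
| TensNullDr v w w' :
    tens_null (<< (v, w + w') >> - (<< (v, w) >> + << (v, w') >>))
| TensNullA v r w : tens_null (<< (ra v r, w) >> - << (v, la r w) >>).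

Definition tens_nullb (x : F) : bool := `[< tens_null x >].

Lemma tens_nullb_closed : zmod_closed tens_nullb.
Proof.
split=> [|x y /asboolP nx /asboolP ny]; apply/asboolP; first exact: TensNull0.
exact: TensNullB.
Qed.

HB.instance Definition _ :=
  GRing.isZmodClosed.Build F tens_nullb tens_nullb_closed.

Definition tens_quot : Type :=
  Quotient.quot (GRing.ZmodClosed.clone F tens_nullb _).
HB.instance Definition _ := GRing.Zmodule.on tens_quot.
HB.instance Definition _ := Quotient.on tens_quot.

(* The wrapper, and the locking below, keep unification from unfolding the
   quotient. *)
Record tens : Type := Tens { tens_val : tens_quot }.

HB.instance Definition _ := gen_eqMixin tens.
HB.instance Definition _ := gen_choiceMixin tens.

Definition balanced (G : zmodType) (f : V -> W -> G) : Prop :=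
  [/\ forall v v' w, f (v + v') w = f v w + f v' w,
      forall v w w', f v (w + w') = f v w + f v w'
    & forall v r w, f (ra v r) w = f v (la r w)].

End Tensor.

HB.lock Definition tens_zero (R : Type) (V W : zmodType) (ra : V -> R -> V)
    (la : R -> W -> W) : tens ra la := Tens 0.
HB.lock Definition tens_opp (R : Type) (V W : zmodType) (ra : V -> R -> V)
    (la : R -> W -> W) (X : tens ra la) : tens ra la := Tens (- tens_val X).
HB.lock Definition tens_add (R : Type) (V W : zmodType) (ra : V -> R -> V)
    (la : R -> W -> W) (X Y : tens ra la) : tens ra la :=
  Tens (tens_val X + tens_val Y).

HB.lock Definition tpure (R : Type) (V W : zmodType) (ra : V -> R -> V)
    (la : R -> W -> W) (v : V) (w : W) : tens ra la :=
  Tens (\pi_(tens_quot ra la) << (v, w) >>).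

(* The additive map induced by [f]; meaningful only if [f] is balanced. *)
HB.lock Definition tlift (R : Type) (V W : zmodType) (ra : V -> R -> V)
    (la : R -> W -> W) (G : zmodType) (f : V -> W -> G) (X : tens ra la) : G :=
  fglift (M := zmodule G) (fun p => f p.1 p.2) (repr (tens_val X)).

Section TensorTheory.
Variables (R : Type) (V W : zmodType) (ra : V -> R -> V) (la : R -> W -> W).

Local Notation F := {freeg (V * W)%type / int}.
Local Notation tens_nullb := (tens_nullb ra la).
Local Notation tens := (tens ra la).
Local Notation tpure := (tpure ra la).
Local Notation balanced := (balanced ra la).
Local Notation tens_null := (tens_null ra la).
Local Notation tens_quot := (tens_quot ra la).
Local Notation tlift := (@tlift R V W ra la _).

Lemma tens_addA : associative (@tens_add R V W ra la).
Proof. by move=> X Y Z; rewrite !tens_add.unlock /= addrA. Qed.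

Lemma tens_addC : commutative (@tens_add R V W ra la).
Proof. by move=> X Y; rewrite !tens_add.unlock /= addrC. Qed.

Lemma tens_add0 : left_id (tens_zero ra la) (@tens_add R V W ra la).
Proof. by case=> X; rewrite tens_add.unlock tens_zero.unlock /= add0r. Qed.

Lemma tens_addN :
  left_inverse (tens_zero ra la) (@tens_opp R V W ra la) (@tens_add R V W ra la).
Proof.
by case=> X; rewrite tens_add.unlock tens_zero.unlock tens_opp.unlock /= addNr.
Qed.

HB.instance Definition _ :=
  GRing.isZmodule.Build tens tens_addA tens_addC tens_add0 tens_addN.

Lemma Tens0 : Tens 0 = 0 :> tens.
Proof. by rewrite -[RHS]/(tens_zero _ _) tens_zero.unlock. Qed.

Lemma TensN (x : tens_quot) : Tens (- x) = - (Tens x : tens).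
Proof. by rewrite -[RHS]/(tens_opp _) tens_opp.unlock. Qed.

Lemma TensD (x y : tens_quot) : Tens (x + y) = (Tens x : tens) + Tens y.
Proof. by rewrite -[RHS]/(tens_add _ _) tens_add.unlock. Qed.

Lemma tens_piD (x y : F) :
  \pi_tens_quot x + \pi_tens_quot y = \pi_tens_quot (x + y).
Proof. by rewrite -[LHS]/(\pi_(Quotient.quot _) x + \pi_(Quotient.quot _) y) !piE. Qed.

Lemma tens_piB (x y : F) : tens_null (x - y) ->
  \pi_tens_quot x = \pi_tens_quot y.
Proof.
by move=> n; apply/eqP; rewrite -Quotient.idealrBE; apply/asboolP.
Qed.

Lemma tpure_balanced : balanced tpure.
Proof.
split=> *; rewrite tpure.unlock -?TensD; congr Tens.
- by rewrite [RHS]tens_piD; apply/tens_piB/TensNullDl.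
- by rewrite [RHS]tens_piD; apply/tens_piB/TensNullDr.
- exact/tens_piB/TensNullA.
Qed.

Section Lift.
Variables (G : zmodType) (f : V -> W -> G).
Hypothesis f_bal : balanced f.

Let g : F -> G := fglift (M := zmodule G) (fun p => f p.1 p.2).

Let gB x y : g (x - y) = g x - g y.
Proof. exact: (@lift_is_additive _ _ (zmodule G) (fun p => f p.1 p.2)). Qed.

Let g0 : g 0 = 0.
Proof. by have := gB 0 0; rewrite !subrr. Qed.

Let gD x y : g (x + y) = g x + g y.
Proof. by rewrite -{1}[y]opprK -[- y]sub0r !gB g0 sub0r opprK. Qed.

Let gU v w : g << (v, w) >> = f v w.
Proof. by rewrite /g liftU scale1r. Qed.

Let g_null x : tens_null x -> g x = 0.
Proof.
have [fDl fDr fA] := f_bal.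
elim=> {x} [//|x y _ gx _ gy|v v' w|v w w'|v r w].
- by rewrite gB gx gy subrr.
- by rewrite gB gD !gU /= fDl subrr.
- by rewrite gB gD !gU /= fDr subrr.
- by rewrite gB !gU /= fA subrr.
Qed.

Let tlift_pi x : tlift f (Tens (\pi_tens_quot x)) = g x.
Proof.
apply/eqP; rewrite -subr_eq0 tlift.unlock /= -/g -gB; apply/eqP/g_null/asboolP.
rewrite -[X in is_true X]/(_ - _ \in tens_nullb).
by rewrite Quotient.idealrBE reprK.
Qed.

Lemma tlift_pure v w : tlift f (tpure v w) = f v w.
Proof. by rewrite tpure.unlock tlift_pi gU. Qed.

Lemma tliftD : {morph tlift f : X Y / X + Y}.
Proof.
case=> X [Y]; rewrite -TensD -[X]reprK -[Y]reprK.
by rewrite tens_piD !tlift_pi gD.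
Qed.

End Lift.

Lemma tens_ind (P : tens -> Prop) :
  (forall v w, P (tpure v w)) -> (forall X Y, P X -> P Y -> P (X + Y)) ->
  forall X, P X.
Proof.
move=> Pp PD [X]; have [pDl pDr pA] := tpure_balanced.
have p0 w : tpure 0 w = 0 by apply: (addIr (tpure 0 w)); rewrite -pDl !add0r.
have P0 : P 0 by rewrite -(p0 0).
have PN v w : P (- tpure v w).
  suff -> : - tpure v w = tpure (- v) w by exact: Pp.
  by apply: (addIr (tpure v w)); rewrite -pDl !addNr p0.
rewrite -[X]reprK.
elim/freeg_ind_dom0: (repr X : F) => [|k [v w] D _ _ PDD].
  rewrite (_ : \pi_tens_quot 0 = 0) ?Tens0 //.
  by rewrite -[LHS]/(\pi_(Quotient.quot _) 0) raddf0.
rewrite -tens_piD TensD; apply: (PD) => // {D PDD}.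
rewrite -[k]intz -freegU_mulz.
suff Pk (n : nat) : P (Tens (\pi_tens_quot (<< (v, w) >> *~ n)))
                 /\ P (Tens (\pi_tens_quot (<< (v, w) >> *~ - n%:Z))).
  by case: k => n; [case: (Pk n) | rewrite NegzE; case: (Pk n.+1)].
have piN x : \pi_tens_quot (- x) = - \pi_tens_quot x.
  by rewrite -[RHS]/(- \pi_(Quotient.quot _) x) !piE.
elim: n => [|n [IH1 IH2]].
  rewrite oppr0 mulr0z (_ : \pi_tens_quot 0 = 0) ?Tens0 //.
  by rewrite -[LHS]/(\pi_(Quotient.quot _) 0) raddf0.
rewrite -addn1 PoszD opprD !mulrzDr !mulrNz mulr1z in IH2 *.
rewrite -!tens_piD !TensD; split; apply: (PD) => //.
  by have := Pp v w; rewrite tpure.unlock.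
by have := PN v w; rewrite tpure.unlock piN TensN.
Qed.

End TensorTheory.

Section LinearForm.
Variables (k : fieldType) (V : lmodType k).

Lemma exists_linear_form (v : V) : v != 0 ->
  exists f : V -> k, (forall c u w, f (c *: u + w) = c * f u + f w) /\ f v = 1.
Proof.
move=> v0.
pose P (A : set V) :=
  (forall c u w, A u -> A w -> A (c *: u + w)) /\ ~ A v.
have [F FP Ftot|A [[Alin Av] Amax]] := @Zorn_bigcup V P.
  split=> [c u w [X FX Xu] [Y FY Yw]|[X FX Xv]]; last by case: (FP _ FX) => _ /(_ Xv).
  have [sXY|sYX] := Ftot _ _ FX FY.
    by exists Y => //; case: (FP _ FY) => + _; apply=> //; apply: sXY.
  by exists X => //; case: (FP _ FX) => + _; apply=> //; apply: sYX.
have A0 : A 0.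
  apply: contrapT => nA0; apply: (Amax [set 0]%classic).
    by split=> [x Ax|/(_ 0 erefl)] //; case: nA0;
       rewrite -(addNr x) -scaleN1r; apply: Alin.
  split=> [c u w -> ->|v0']; first by rewrite scaler0 addr0.
  by rewrite v0' eqxx in v0.
have Adec u : exists c, A (u - c *: v).
  have [Au|nAu] := pselect (A u); first by exists 0; rewrite scale0r subr0.
  pose B := [set x | exists c, A (x - c *: u)]%classic.
  have AB : (A `<=` B)%classic by move=> x Ax; exists 0; rewrite scale0r subr0.
  have Bu : B u by exists 1; rewrite scale1r subrr.
  have nBA : ~ (B `<=` A)%classic by move=> /(_ _ Bu).
  have : B v.
    apply: contrapT => nBv; apply: (Amax B) => //; split=> //.
    move=> c x y [a Aa] [b Ab]; exists (c * a + b).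
    suff -> : c *: x + y - (c * a + b) *: u =
      c *: (x - a *: u) + (y - b *: u) by exact: Alin.
    by rewrite scalerBr scalerDl scalerA opprD addrACA.
  case=> c Ac; have c0 : c != 0.
    by apply: contra_notN Av => /eqP c0; rewrite c0 scale0r subr0 in Ac.
  exists c^-1; rewrite -[X in A X](addr0).
  suff -> : u - c^-1 *: v = (- c^-1) *: (v - c *: u) by exact: Alin.
  by rewrite scalerBr scalerA mulNr mulVf // !scaleNr scale1r opprK addrC.
have Auniq u c c' : A (u - c *: v) -> A (u - c' *: v) -> c = c'.
  move=> Ac Ac'; apply: contrapT => /eqP; rewrite -subr_eq0 => cc'; apply: Av.
  have -> : v = (c - c')^-1 *: (- 1 *: (u - c *: v) + (u - c' *: v)) + 0.
    by rewrite addr0 scaleN1r opprB addrA subrK -scalerBl scalerA mulVf ?scale1r.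
  by apply/Alin => //; apply: Alin.
have [f fP] := choice Adec; exists f; split=> [c u w|].
  apply: Auniq (fP _) _.
  suff -> : c *: u + w - (c * f u + f w) *: v =
    c *: (u - f u *: v) + (w - f w *: v) by exact: Alin.
  by rewrite scalerBr scalerDl scalerA opprD addrACA.
by apply: Auniq (fP _) _; rewrite scale1r subrr.
Qed.

End LinearForm.

Section TensorOverField.
Variable k : fieldType.

(* The factors are algebras rather than mere vector spaces so that the type of
   an iterated tensor product has a single inferred form. *)
Section Module.
Variables V W : algType k.

Definition tensor : Type :=
  tens (fun (v : V) (c : k) => c *: v) (fun (c : k) (w : W) => c *: w).
HB.instance Definition _ := GRing.Zmodule.on tensor.

Definition tprod (v : V) (w : W) : tensor :=
  tpure (fun v (c : k) => c *: v) (fun c w => c *: w) v w.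

Definition bilin (G : zmodType) (f : V -> W -> G) : Prop :=
  balanced (fun (v : V) (c : k) => c *: v) (fun (c : k) (w : W) => c *: w) f.

Definition tensor_lift (G : zmodType) (f : V -> W -> G) (X : tensor) : G :=
  tlift f X.

Lemma tensor_lift_prod (G : zmodType) (f : V -> W -> G) v w :
  bilin f -> tensor_lift f (tprod v w) = f v w.
Proof. by move=> fb; apply: tlift_pure. Qed.

Lemma tensor_liftD (G : zmodType) (f : V -> W -> G) : bilin f ->
  {morph tensor_lift f : X Y / X + Y}.
Proof. by move=> fb X Y; apply: tliftD. Qed.

Lemma tprod_bilin : bilin tprod.
Proof. exact: tpure_balanced. Qed.

Lemma tprodDl v v' w : tprod (v + v') w = tprod v w + tprod v' w.
Proof. by have [-> _ _] := tprod_bilin. Qed.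

Lemma tprodDr v w w' : tprod v (w + w') = tprod v w + tprod v w'.
Proof. by have [_ -> _] := tprod_bilin. Qed.

Lemma tprodZ c v w : tprod (c *: v) w = tprod v (c *: w).
Proof. by have [_ _ ->] := tprod_bilin. Qed.

Lemma tensor_ind (P : tensor -> Prop) :
  (forall v w, P (tprod v w)) -> (forall X Y, P X -> P Y -> P (X + Y)) ->
  forall X, P X.
Proof. exact: tens_ind. Qed.

Definition tensor_scale (c : k) : tensor -> tensor :=
  tensor_lift (fun v w => tprod (c *: v) w).

Lemma tensor_scale_bilin c : bilin (fun v w => tprod (c *: v) w).
Proof.
split=> *; first by rewrite scalerDr tprodDl.
  by rewrite tprodDr.
by rewrite scalerA mulrC -scalerA tprodZ.
Qed.

Lemma tensor_scale_prod c v w : tensor_scale c (tprod v w) = tprod (c *: v) w.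
Proof. by rewrite /tensor_scale tensor_lift_prod //; apply: tensor_scale_bilin. Qed.

Lemma tensor_scaleDr : right_distributive tensor_scale +%R.
Proof. by move=> c X Y; apply/tensor_liftD/tensor_scale_bilin. Qed.

Lemma tensor_scaleA a b X :
  tensor_scale a (tensor_scale b X) = tensor_scale (a * b) X.
Proof.
elim/tensor_ind: X => [v w|X Y IHX IHY]; last by rewrite !tensor_scaleDr IHX IHY.
by rewrite !tensor_scale_prod scalerA.
Qed.

Lemma tensor_scale1 : left_id 1 tensor_scale.
Proof.
elim/tensor_ind => [v w|X Y IHX IHY]; last by rewrite !tensor_scaleDr IHX IHY.
by rewrite tensor_scale_prod scale1r.
Qed.

Lemma tensor_scaleDl X : {morph tensor_scale^~ X : a b / a + b}.
Proof.
move=> a b; elim/tensor_ind: X => [v w|X Y IHX IHY].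
  by rewrite !tensor_scale_prod scalerDl tprodDl.
by rewrite !tensor_scaleDr IHX IHY addrACA.
Qed.

HB.instance Definition _ := GRing.Zmodule_isLmodule.Build k tensor
  tensor_scaleA tensor_scale1 tensor_scaleDr tensor_scaleDl.

Lemma scale_tprod c v w : c *: tprod v w = tprod (c *: v) w.
Proof. exact: tensor_scale_prod. Qed.

End Module.

Local Notation "v ⊗ w" := (tprod v w) (at level 40, left associativity).

Lemma tprod_eq0 (V W : algType k) (v : V) (w : W) :
  v != 0 -> w != 0 -> v ⊗ w != 0.
Proof.
move=> /exists_linear_form[f [flin fv]] /exists_linear_form[g [glin gw]].
have lin0 (U : lmodType k) (h : U -> k) :
    (forall c u w, h (c *: u + w) = c * h u + h w) ->
    (forall u u', h (u + u') = h u + h u') /\ (forall c u, h (c *: u) = c * h u).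
  move=> hl; have hD u u' : h (u + u') = h u + h u'.
    by rewrite -{1}[u]scale1r hl mul1r.
  split=> // c u; apply: (addIr (h 0)); rewrite -hD -hl addr0 //.
have [fD fZ] := lin0 _ _ flin; have [gD gZ] := lin0 _ _ glin.
have fgb : bilin (fun v w => f v * g w : k).
  by split=> *; rewrite ?fD ?gD ?fZ ?gZ ?mulrDl ?mulrDr // mulrCA mulrA.
apply/eqP => vw0.
have := tensor_lift_prod v w fgb; rewrite vw0 fv gw mulr1.
have -> : tensor_lift (fun v w => f v * g w : k) (0 : tensor V W) = 0.
  apply: (addIr (tensor_lift (fun v w => f v * g w : k) (0 : tensor V W))).
  by rewrite -tensor_liftD // !add0r.
by move/esym/eqP; rewrite oner_eq0.
Qed.

Section Algebra.
Variables A B : algType k.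

Definition tensor_mul (X Y : tensor A B) : tensor A B :=
  tensor_lift (fun a b => tensor_lift (fun a' b' => (a * a') ⊗ (b * b')) Y) X.

Lemma tensor_mul_bilin1 a b :
  bilin (fun (a' : A) (b' : B) => (a * a') ⊗ (b * b')).
Proof.
by split=> *; rewrite ?mulrDr ?tprodDl ?tprodDr // -!scalerAr tprodZ.
Qed.

Lemma tensor_mul_bilin2 (Y : tensor A B) : bilin (fun (a : A) (b : B) =>
  tensor_lift (fun a' b' => (a * a') ⊗ (b * b')) Y).
Proof.
have b1 := tensor_mul_bilin1.
split=> [a a' b|a b b'|a c b].
- elim/tensor_ind: Y => [v w|X Y IHX IHY].
    by rewrite !tensor_lift_prod // mulrDl tprodDl.
  by rewrite !tensor_liftD // IHX IHY addrACA.
- elim/tensor_ind: Y => [v w|X Y IHX IHY].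
    by rewrite !tensor_lift_prod // mulrDl tprodDr.
  by rewrite !tensor_liftD // IHX IHY addrACA.
- elim/tensor_ind: Y => [v w|X Y IHX IHY].
    by rewrite !tensor_lift_prod // -!scalerAl tprodZ.
  by rewrite !tensor_liftD // IHX IHY.
Qed.

Lemma tensor_mul_prod a b a' b' :
  tensor_mul (a ⊗ b) (a' ⊗ b') = (a * a') ⊗ (b * b').
Proof.
rewrite /tensor_mul tensor_lift_prod; last exact: tensor_mul_bilin2.
by rewrite tensor_lift_prod //; apply: tensor_mul_bilin1.
Qed.

Lemma tensor_mulDl : left_distributive tensor_mul +%R.
Proof. by move=> X Y Z; apply/tensor_liftD/tensor_mul_bilin2. Qed.

Lemma tensor_mulDr : right_distributive tensor_mul +%R.
Proof.
move=> X Y Z; elim/tensor_ind: X => [a b|X X' IH IH'].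
  rewrite /tensor_mul !tensor_lift_prod; try exact: tensor_mul_bilin2.
  by rewrite tensor_liftD //; apply: tensor_mul_bilin1.
by rewrite !tensor_mulDl IH IH' addrACA.
Qed.

Lemma tensor_mulA : associative tensor_mul.
Proof.
move=> X Y Z; elim/tensor_ind: X => [a b|X X' IH IH']; last first.
  by rewrite !tensor_mulDl IH IH'.
elim/tensor_ind: Y => [a' b'|Y Y' IH IH']; last first.
  by rewrite !(tensor_mulDl, tensor_mulDr) IH IH'.
elim/tensor_ind: Z => [a2 b2|Z Z' IH IH']; last by rewrite !tensor_mulDr IH IH'.
by rewrite !tensor_mul_prod !mulrA.
Qed.

Lemma tensor_mul1l : left_id (1 ⊗ 1) tensor_mul.
Proof.
elim/tensor_ind => [a b|X Y IH IH']; last by rewrite tensor_mulDr IH IH'.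
by rewrite tensor_mul_prod !mul1r.
Qed.

Lemma tensor_mul1r : right_id (1 ⊗ 1) tensor_mul.
Proof.
elim/tensor_ind => [a b|X Y IH IH']; last by rewrite tensor_mulDl IH IH'.
by rewrite tensor_mul_prod !mulr1.
Qed.

HB.instance Definition _ := GRing.Zmodule_isNzRing.Build (tensor A B)
  tensor_mulA tensor_mul1l tensor_mul1r tensor_mulDl tensor_mulDr
  (tprod_eq0 (oner_neq0 A) (oner_neq0 B)).

Lemma mul_tprod (a a' : A) (b b' : B) : (a ⊗ b) * (a' ⊗ b') = (a * a') ⊗ (b * b').
Proof. exact: tensor_mul_prod. Qed.

Lemma one_tprod : 1 = 1 ⊗ 1 :> tensor A B.
Proof. by []. Qed.

Lemma tensor_scalerAl c (X Y : tensor A B) : c *: (X * Y) = (c *: X) * Y.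
Proof.
elim/tensor_ind: X => [a b|X X' IH IH']; last first.
  by rewrite mulrDl !scalerDr IH IH' mulrDl.
elim/tensor_ind: Y => [a' b'|Y Y' IH IH']; last first.
  by rewrite !mulrDr scalerDr IH IH'.
by rewrite mul_tprod !scale_tprod mul_tprod scalerAl.
Qed.

HB.instance Definition _ :=
  GRing.Lmodule_isLalgebra.Build k (tensor A B) tensor_scalerAl.

Lemma tensor_scalerAr c (X Y : tensor A B) : c *: (X * Y) = X * (c *: Y).
Proof.
elim/tensor_ind: X => [a b|X X' IH IH']; last first.
  by rewrite mulrDl scalerDr IH IH' mulrDl.
elim/tensor_ind: Y => [a' b'|Y Y' IH IH']; last first.
  by rewrite !mulrDr scalerDr IH IH' -mulrDr -scalerDr.
by rewrite mul_tprod !scale_tprod mul_tprod scalerAr.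
Qed.

HB.instance Definition _ :=
  GRing.Lalgebra_isAlgebra.Build k (tensor A B) tensor_scalerAr.

End Algebra.
End TensorOverField.

Notation "v ⊗ w" := (tprod v w) (at level 40, left associativity) : ring_scope.

Section TensorMaps.
Variable k : fieldType.

Definition tensor_map (V W V' W' : algType k) (f : V -> V') (g : W -> W')
    (X : tensor V W) : tensor V' W' := tensor_lift (fun v w => f v ⊗ g w) X.

Definition tensor_swap (V W : algType k) (X : tensor V W) : tensor W V :=
  tensor_lift (fun v w => w ⊗ v) X.

Definition tensor_assoc (U V W : algType k) (X : tensor U (tensor V W)) :
    tensor (tensor U V) W :=
  tensor_lift (fun u Y => tensor_lift (fun v w => (u ⊗ v) ⊗ w) Y) X.

Lemma tensor_map_bilin (V W V' W' : algType k)
    (f : {linear V -> V'}) (g : {linear W -> W'}) : bilin (fun v w => f v ⊗ g w).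
Proof. by split=> *; rewrite ?linearD ?linearZ ?tprodDl ?tprodDr //= tprodZ. Qed.

Lemma tensor_map_prod (V W V' W' : algType k)
    (f : {linear V -> V'}) (g : {linear W -> W'}) v w :
  tensor_map f g (v ⊗ w) = f v ⊗ g w.
Proof. exact/tensor_lift_prod/tensor_map_bilin. Qed.

Lemma tensor_mapD (V W V' W' : algType k)
    (f : {linear V -> V'}) (g : {linear W -> W'}) :
  {morph tensor_map f g : X Y / X + Y}.
Proof. exact/tensor_liftD/tensor_map_bilin. Qed.

Lemma tensor_mapM (A B A' B' : algType k)
    (f : {lrmorphism A -> A'}) (g : {lrmorphism B -> B'}) :
  {morph tensor_map f g : X Y / X * Y}.
Proof.
move=> X Y; elim/tensor_ind: X => [a b|X X' IH IH']; last first.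
  by rewrite mulrDl !tensor_mapD IH IH' mulrDl.
elim/tensor_ind: Y => [a' b'|Y Y' IH IH']; last first.
  by rewrite mulrDr !tensor_mapD IH IH' mulrDr.
by rewrite mul_tprod !tensor_map_prod mul_tprod !rmorphM.
Qed.

Lemma tensor_swap_bilin (V W : algType k) :
  bilin (fun (v : V) (w : W) => w ⊗ v).
Proof. by split=> *; rewrite ?tprodDl ?tprodDr ?tprodZ. Qed.

Lemma tensor_swap_prod (V W : algType k) (v : V) (w : W) :
  tensor_swap (v ⊗ w) = w ⊗ v.
Proof. exact/tensor_lift_prod/tensor_swap_bilin. Qed.

Lemma tensor_swapD (V W : algType k) :
  {morph @tensor_swap V W : X Y / X + Y}.
Proof. exact/tensor_liftD/tensor_swap_bilin. Qed.

Lemma tensor_swapZ (V W : algType k) c (X : tensor V W) :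
  tensor_swap (c *: X) = c *: tensor_swap X.
Proof.
elim/tensor_ind: X => [v w|X Y IH IH'].
  by rewrite scale_tprod !tensor_swap_prod scale_tprod tprodZ.
by rewrite scalerDr !tensor_swapD IH IH' scalerDr.
Qed.

Lemma tensor_swapM (A B : algType k) : {morph @tensor_swap A B : X Y / X * Y}.
Proof.
move=> X Y; elim/tensor_ind: X => [a b|X X' IH IH']; last first.
  by rewrite mulrDl !tensor_swapD IH IH' mulrDl.
elim/tensor_ind: Y => [a' b'|Y Y' IH IH']; last first.
  by rewrite mulrDr !tensor_swapD IH IH' mulrDr.
by rewrite mul_tprod !tensor_swap_prod mul_tprod.
Qed.

HB.instance Definition _ (A B : algType k) := GRing.isSemilinear.Build k
  (tensor A B) (tensor B A) *:%R (@tensor_swap A B)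
  (@tensor_swapZ A B, @tensor_swapD A B).
HB.instance Definition _ (A B : algType k) := GRing.isMonoidMorphism.Build
  (tensor A B) (tensor B A) (@tensor_swap A B)
  (tensor_swap_prod 1 1, @tensor_swapM A B).

Lemma tensor_assoc_bilin1 (U V W : algType k) (u : U) :
  bilin (fun (v : V) (w : W) => (u ⊗ v) ⊗ w).
Proof.
by split=> *; rewrite ?tprodDr ?tprodDl // -tprodZ -scale_tprod tprodZ.
Qed.

Lemma tensor_assoc_bilin (U V W : algType k) :
  bilin (fun (u : U) (Y : tensor V W) =>
    tensor_lift (fun v w => (u ⊗ v) ⊗ w) Y).
Proof.
have b1 := tensor_assoc_bilin1.
split=> [u u' Y|u Y Y'|u c Y].
- elim/tensor_ind: Y => [v w|X Y IH IH'].
    by rewrite !tensor_lift_prod // !tprodDl.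
  by rewrite !tensor_liftD // IH IH' addrACA.
- by rewrite tensor_liftD.
- elim/tensor_ind: Y => [v w|X Y IH IH'].
    by rewrite scale_tprod !tensor_lift_prod // tprodZ.
  by rewrite scalerDr !tensor_liftD // IH IH'.
Qed.

Lemma tensor_assoc_prod (U V W : algType k) (u : U) (v : V) (w : W) :
  tensor_assoc (u ⊗ (v ⊗ w)) = (u ⊗ v) ⊗ w.
Proof.
rewrite /tensor_assoc tensor_lift_prod; last exact: tensor_assoc_bilin.
exact/tensor_lift_prod/tensor_assoc_bilin1.
Qed.

Lemma tensor_assocD (U V W : algType k) :
  {morph @tensor_assoc U V W : X Y / X + Y}.
Proof. exact/tensor_liftD/tensor_assoc_bilin. Qed.

Lemma tensor_assocM (A B C : algType k) :
  {morph @tensor_assoc A B C : X Y / X * Y}.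
Proof.
move=> X Y; elim/tensor_ind: X => [a X|X X' IH IH']; last first.
  by rewrite mulrDl !tensor_assocD IH IH' mulrDl.
elim/tensor_ind: X => [b c|X X' IH IH']; last first.
  by rewrite tprodDr mulrDl !tensor_assocD IH IH' mulrDl.
elim/tensor_ind: Y => [a' Y|Y Y' IH IH']; last first.
  by rewrite mulrDr !tensor_assocD IH IH' mulrDr.
elim/tensor_ind: Y => [b' c'|Y Y' IH IH']; last first.
  by rewrite tprodDr mulrDr !tensor_assocD IH IH' mulrDr.
by rewrite !(mul_tprod, tensor_assoc_prod).
Qed.

End TensorMaps.

HB.mixin Record Algebra_isHopfAlgebra (k : fieldType) H of GRing.Algebra k H := {
  comul : {lrmorphism H -> tensor H H};
  counit : {lrmorphism H -> k^o};
  antipode : {linear H -> H};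
  comulA : forall h : H,
    tensor_assoc (tensor_map idfun comul (comul h)) =
    tensor_map comul idfun (comul h);
  counitl : forall h : H, tensor_lift (fun a b => counit a *: b) (comul h) = h;
  counitr : forall h : H, tensor_lift (fun a b => counit b *: a) (comul h) = h;
  antipodel : forall h : H,
    tensor_lift (fun a b => antipode a * b) (comul h) = (counit h : k)%:A;
  antipoder : forall h : H,
    tensor_lift (fun a b => a * antipode b) (comul h) = (counit h : k)%:A
}.

#[short(type="hopfAlgType")]
HB.structure Definition HopfAlgebra (k : fieldType) :=
  {H of GRing.Algebra k H & Algebra_isHopfAlgebra k H}.

HB.mixin Record HopfAlgebra_isCocommutative (k : fieldType) H
    of HopfAlgebra k H := {
  comulC : forall h : H, tensor_swap (comul h) = comul h
}.

#[short(type="cocommHopfAlgType")]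
HB.structure Definition CocommHopfAlgebra (k : fieldType) :=
  {H of HopfAlgebra k H & HopfAlgebra_isCocommutative k H}.

(* B ⊗_H M, for B a right H-module via right multiplication through [phi],
   as a left B-module. *)
Section ScalarExtension.
Variables (H B : pzRingType) (phi : H -> B) (M : lmodType H).

Definition ext_scalars : Type :=
  tens (fun (b : B) (h : H) => b * phi h) (fun (h : H) (m : M) => h *: m).
HB.instance Definition _ := GRing.Zmodule.on ext_scalars.

Definition ext_prod (b : B) (m : M) : ext_scalars :=
  tpure (fun (b : B) (h : H) => b * phi h) (fun (h : H) (m : M) => h *: m) b m.

Definition ext_balanced (G : zmodType) (f : B -> M -> G) : Prop :=
  balanced (fun (b : B) (h : H) => b * phi h)
    (fun (h : H) (m : M) => h *: m) f.

Definition ext_lift (G : zmodType) (f : B -> M -> G) (X : ext_scalars) : G :=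
  tlift f X.

Lemma ext_lift_prod (G : zmodType) (f : B -> M -> G) b m :
  ext_balanced f -> ext_lift f (ext_prod b m) = f b m.
Proof. by move=> fb; apply: tlift_pure. Qed.

Lemma ext_liftD (G : zmodType) (f : B -> M -> G) : ext_balanced f ->
  {morph ext_lift f : X Y / X + Y}.
Proof. by move=> fb X Y; apply: tliftD. Qed.

Lemma ext_prod_balanced : ext_balanced ext_prod.
Proof. exact: tpure_balanced. Qed.

Lemma ext_prodDl b b' m : ext_prod (b + b') m = ext_prod b m + ext_prod b' m.
Proof. by have [-> _ _] := ext_prod_balanced. Qed.

Lemma ext_prodDr b m m' : ext_prod b (m + m') = ext_prod b m + ext_prod b m'.
Proof. by have [_ -> _] := ext_prod_balanced. Qed.

Lemma ext_prodA b h m : ext_prod (b * phi h) m = ext_prod b (h *: m).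
Proof. by have [_ _ ->] := ext_prod_balanced. Qed.

Lemma ext_ind (P : ext_scalars -> Prop) :
  (forall b m, P (ext_prod b m)) -> (forall X Y, P X -> P Y -> P (X + Y)) ->
  forall X, P X.
Proof. exact: tens_ind. Qed.

Definition ext_scale (b : B) : ext_scalars -> ext_scalars :=
  ext_lift (fun b' m => ext_prod (b * b') m).

Lemma ext_scale_balanced b : ext_balanced (fun b' m => ext_prod (b * b') m).
Proof. by split=> *; rewrite ?mulrDr ?ext_prodDl ?ext_prodDr ?mulrA ?ext_prodA. Qed.

Lemma ext_scale_prod b b' m : ext_scale b (ext_prod b' m) = ext_prod (b * b') m.
Proof. by rewrite /ext_scale ext_lift_prod //; apply: ext_scale_balanced. Qed.

Lemma ext_scaleDr : right_distributive ext_scale +%R.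
Proof. by move=> b X Y; apply/ext_liftD/ext_scale_balanced. Qed.

Lemma ext_scaleA a b X : ext_scale a (ext_scale b X) = ext_scale (a * b) X.
Proof.
elim/ext_ind: X => [b' m|X Y IHX IHY]; last by rewrite !ext_scaleDr IHX IHY.
by rewrite !ext_scale_prod mulrA.
Qed.

Lemma ext_scale1 : left_id 1 ext_scale.
Proof.
elim/ext_ind => [b m|X Y IHX IHY]; last by rewrite !ext_scaleDr IHX IHY.
by rewrite ext_scale_prod mul1r.
Qed.

Lemma ext_scaleDl X : {morph ext_scale^~ X : a b / a + b}.
Proof.
move=> a b; elim/ext_ind: X => [b' m|X Y IHX IHY].
  by rewrite !ext_scale_prod mulrDl ext_prodDl.
by rewrite !ext_scaleDr IHX IHY addrACA.
Qed.

HB.instance Definition _ := GRing.Zmodule_isLmodule.Build B ext_scalars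
  ext_scaleA ext_scale1 ext_scaleDr ext_scaleDl.

Lemma scale_ext_prod b b' m : b *: ext_prod b' m = ext_prod (b * b') m.
Proof. exact: ext_scale_prod. Qed.

End ScalarExtension.

(* sigma ⊗_H id : B ⊗_H M -> C ⊗_H M; well defined if sigma is additive and
   sigma (b * phi h) = sigma b * psi h. *)
Definition ext_map (H B C : pzRingType) (phi : H -> B) (psi : H -> C)
    (M : lmodType H) (sigma : B -> C) (X : ext_scalars phi M) :
    ext_scalars psi M :=
  ext_lift (fun b m => ext_prod psi (sigma b) m) X.

Section ExtMap.
Variables (H B C : pzRingType) (phi : H -> B) (psi : H -> C) (M : lmodType H).
Variable sigma : B -> C.
Hypotheses (sigmaD : {morph sigma : x y / x + y})
  (sigmaM : forall b h, sigma (b * phi h) = sigma b * psi h).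

Let sigma_balanced :
  ext_balanced phi (fun b (m : M) => ext_prod psi (sigma b) m).
Proof.
by split=> *; rewrite ?sigmaD ?sigmaM ?ext_prodDl ?ext_prodDr ?ext_prodA.
Qed.

Lemma ext_map_prod b (m : M) :
  ext_map psi sigma (ext_prod phi b m) = ext_prod psi (sigma b) m.
Proof. exact: ext_lift_prod. Qed.

Lemma ext_mapD :
  {morph ext_map (phi := phi) (M := M) psi sigma : X Y / X + Y}.
Proof. exact: ext_liftD. Qed.

End ExtMap.

Section Pseudoalgebra.
Variables (k : fieldType) (H : cocommHopfAlgType k).

Notation H2 := (tensor H H).
Notation H3 := (tensor (tensor H H) H).

(* H3 is bracketed to the left, so 1 ⊗ F and (id ⊗ Delta) F are transported to
   it along tensor_assoc. *)
Definition comul3 (h : H) : H3 := tensor_map comul idfun (comul h).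

Definition comul_id : H2 -> H3 := tensor_map comul idfun.
Definition id_comul (F : H2) : H3 := tensor_assoc (tensor_map idfun comul F).
Definition swap12 : H3 -> H3 := tensor_map (@tensor_swap k H H) idfun.

Definition ps2 (M : lmodType H) : Type := ext_scalars (comul : H -> H2) M.
HB.instance Definition _ (M : lmodType H) := GRing.Lmodule.on (ps2 M).

Definition ps3 (M : lmodType H) : Type := ext_scalars comul3 M.
HB.instance Definition _ (M : lmodType H) := GRing.Lmodule.on (ps3 M).

Definition transp2 (M : lmodType H) (X : ps2 M) : ps2 M :=
  ext_map comul (@tensor_swap k H H) X.
Definition transp3 (M : lmodType H) (X : ps3 M) : ps3 M :=
  ext_map comul3 swap12 X.

Lemma comul_idM F h : comul_id (F * comul h) = comul_id F * comul3 h.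
Proof. exact: tensor_mapM. Qed.

Lemma id_comulM F h : id_comul (F * comul h) = id_comul F * comul3 h.
Proof. by rewrite /id_comul tensor_mapM tensor_assocM comulA. Qed.

Lemma swap12M (F : H3) h : swap12 (F * comul3 h) = swap12 F * comul3 h.
Proof.
rewrite /swap12 tensor_mapM; congr (_ * _); rewrite /comul3.
elim/tensor_ind: (comul h : H2) => [a b|X Y IH IH'].
  by rewrite !tensor_map_prod /= comulC.
by rewrite !tensor_mapD IH IH'.
Qed.

Lemma transp2_prod (M : lmodType H) (F : H2) (m : M) :
  transp2 (ext_prod comul F m) = ext_prod comul (tensor_swap F) m.
Proof.
apply: ext_map_prod => [X Y|b h]; first exact: tensor_swapD.
by rewrite tensor_swapM comulC.
Qed.

Lemma transp2D (M : lmodType H) : {morph @transp2 M : X Y / X + Y}.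
Proof.
apply: ext_mapD => [X Y|b h]; first exact: tensor_swapD.
by rewrite tensor_swapM comulC.
Qed.

Lemma transp3_prod (M : lmodType H) (F : H3) (m : M) :
  transp3 (ext_prod comul3 F m) = ext_prod comul3 (swap12 F) m.
Proof. by apply: ext_map_prod; [exact: tensor_mapD | exact: swap12M]. Qed.

Lemma transp3D (M : lmodType H) : {morph @transp3 M : X Y / X + Y}.
Proof. by apply: ext_mapD; [exact: tensor_mapD | exact: swap12M]. Qed.

(* (Delta ⊗ id) ⊗_H id and (id ⊗ Delta) ⊗_H id, from H2 ⊗_H M to H3 ⊗_H M. *)
Definition comul_id_ps (M : lmodType H) (X : ps2 M) : ps3 M :=
  ext_map comul3 comul_id X.
Definition id_comul_ps (M : lmodType H) (X : ps2 M) : ps3 M :=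
  ext_map comul3 id_comul X.

Lemma comul_id_ps_prod (M : lmodType H) (F : H2) (m : M) :
  comul_id_ps (ext_prod comul F m) = ext_prod comul3 (comul_id F) m.
Proof. by apply: ext_map_prod; [exact: tensor_mapD | exact: comul_idM]. Qed.

Lemma comul_id_psD (M : lmodType H) : {morph @comul_id_ps M : X Y / X + Y}.
Proof. by apply: ext_mapD; [exact: tensor_mapD | exact: comul_idM]. Qed.

Lemma comul_id_psZ (M : lmodType H) F (X : ps2 M) :
  comul_id_ps (F *: X) = comul_id F *: comul_id_ps X.
Proof.
elim/ext_ind: X => [b m|X Y IH IH']; last first.
  by rewrite scalerDr !comul_id_psD IH IH' scalerDr.
rewrite comul_id_ps_prod -[_ *: ext_prod _ _ _]/(ext_scale _ _).
rewrite -[_ *: ext_prod _ _ _ in RHS]/(ext_scale _ _).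
by rewrite !ext_scale_prod comul_id_ps_prod /comul_id tensor_mapM.
Qed.

Lemma id_comulD : {morph id_comul : X Y / X + Y}.
Proof. by move=> X Y; rewrite /id_comul tensor_mapD tensor_assocD. Qed.

Lemma id_comul_ps_prod (M : lmodType H) (F : H2) (m : M) :
  id_comul_ps (ext_prod comul F m) = ext_prod comul3 (id_comul F) m.
Proof. by apply: ext_map_prod; [exact: id_comulD | exact: id_comulM]. Qed.

Lemma id_comul_psD (M : lmodType H) : {morph @id_comul_ps M : X Y / X + Y}.
Proof. by apply: ext_mapD; [exact: id_comulD | exact: id_comulM]. Qed.

Lemma id_comul_psZ (M : lmodType H) F (X : ps2 M) :
  id_comul_ps (F *: X) = id_comul F *: id_comul_ps X.
Proof.
elim/ext_ind: X => [b m|X Y IH IH']; last first.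
  by rewrite scalerDr !id_comul_psD IH IH' scalerDr.
rewrite id_comul_ps_prod -[_ *: ext_prod _ _ _]/(ext_scale _ _).
rewrite -[_ *: ext_prod _ _ _ in RHS]/(ext_scale _ _).
by rewrite !ext_scale_prod id_comul_ps_prod /id_comul tensor_mapM tensor_assocM.
Qed.

(* k acts on an H-module through c |-> c%:A. *)
Record pseudo_bilinear (L M N : lmodType H) (op : L -> M -> ps2 N) : Prop := {
  pseudoDl : forall a a' b, op (a + a') b = op a b + op a' b;
  pseudoDr : forall a b b', op a (b + b') = op a b + op a b';
  pseudoZl : forall (c : k) a b,
    op ((c%:A : H) *: a) b = (c%:A : H2) *: op a b;
  pseudoZr : forall (c : k) a b,
    op a ((c%:A : H) *: b) = (c%:A : H2) *: op a b;
  pseudoM : forall (f g : H) a b, op (f *: a) (g *: b) = (f ⊗ g) *: op a b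
}.

(* (F ⊗_H x) * y and x * (F ⊗_H y), extended additively; see comp_l_prod and
   comp_r_prod below. *)
Definition comp_l (L M N : lmodType H) (op : L -> M -> ps2 N)
    (X : ps2 L) (y : M) : ps3 N :=
  ext_lift (fun (F : H2) x =>
    ((F ⊗ 1 : H3) *: comul_id_ps (op x y))) X.

Definition comp_r (L M N : lmodType H) (op : L -> M -> ps2 N)
    (x : L) (Y : ps2 M) : ps3 N :=
  ext_lift (fun (F : H2) y =>
    ((tensor_assoc (1 ⊗ F) : H3) *: id_comul_ps (op x y)))
    Y.

Section Composition.
Variables (L M N : lmodType H) (op : L -> M -> ps2 N).
Hypothesis op_bil : pseudo_bilinear op.

Let pseudoMl (f : H) a b : op (f *: a) b = (f ⊗ 1) *: op a b.
Proof. by rewrite -{1}[b]scale1r (pseudoM op_bil). Qed.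

Let pseudoMr (g : H) a b : op a (g *: b) = (1 ⊗ g) *: op a b.
Proof. by rewrite -{1}[a]scale1r (pseudoM op_bil). Qed.

Let comp_l_balanced y : ext_balanced (comul : H -> H2)
  (fun (F : H2) x => (F ⊗ 1 : H3) *: comul_id_ps (op x y)).
Proof.
split=> [F F' x|F x x'|F h x].
- by rewrite tprodDl scalerDl.
- by rewrite (pseudoDl op_bil) comul_id_psD scalerDr.
- rewrite pseudoMl comul_id_psZ scalerA; congr (_ *: _).
  by rewrite /comul_id tensor_map_prod mul_tprod mulr1.
Qed.

Let comp_r_balanced x : ext_balanced (comul : H -> H2)
  (fun (F : H2) y => (tensor_assoc (1 ⊗ F) : H3) *: id_comul_ps (op x y)).
Proof.
split=> [F F' y|F y y'|F h y].
- by rewrite tprodDr tensor_assocD scalerDl.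
- by rewrite (pseudoDr op_bil) id_comul_psD scalerDr.
- rewrite pseudoMr id_comul_psZ scalerA; congr (_ *: _).
  by rewrite /id_comul tensor_map_prod -tensor_assocM mul_tprod mulr1.
Qed.

Lemma comp_l_prod (F : H2) x y :
  comp_l op (ext_prod comul F x) y = (F ⊗ 1 : H3) *: comul_id_ps (op x y).
Proof. exact/ext_lift_prod/comp_l_balanced. Qed.

Lemma comp_lD X X' y : comp_l op (X + X') y = comp_l op X y + comp_l op X' y.
Proof. exact/ext_liftD/comp_l_balanced. Qed.

Lemma comp_r_prod x (F : H2) y :
  comp_r op x (ext_prod comul F y) =
  (tensor_assoc (1 ⊗ F) : H3) *: id_comul_ps (op x y).
Proof. exact/ext_lift_prod/comp_r_balanced. Qed.

Lemma comp_rD x Y Y' : comp_r op x (Y + Y') = comp_r op x Y + comp_r op x Y'.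
Proof. exact/ext_liftD/comp_r_balanced. Qed.

End Composition.

Record dendriform (A : lmodType H) (prec succ : A -> A -> ps2 A) : Prop := {
  dendriform_prec : pseudo_bilinear prec;
  dendriform_succ : pseudo_bilinear succ;
  dendriform_precA : forall x y z,
    comp_l prec (prec x y) z = comp_r prec x (prec y z + succ y z);
  dendriform_succ_prec : forall x y z,
    comp_l prec (succ x y) z = comp_r succ x (prec y z);
  dendriform_succA : forall x y z,
    comp_l succ (prec x y + succ x y) z = comp_r succ x (succ y z)
}.

Record pre_lie (A : lmodType H) (op : A -> A -> ps2 A) : Prop := {
  pre_lie_bilinear : pseudo_bilinear op;
  pre_lie_assoc : forall x y z,
    comp_l op (op x y) z - comp_r op x (op y z) =
    transp3 (comp_l op (op y x) z - comp_r op y (op x z))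
}.

End Pseudoalgebra.

(* Main.v *)
Require Import Defs.
From HB Require Import structures.
From mathcomp Require Import all_boot all_algebra.

(** In an ordinary dendriform algebra the associator of x > y - y < x
    (with < for prec and > for succ) reduces,
    by the three axioms, to
      x > (z < y) + y > (z < x) - (x < y + y < x) > z - z < (x > y + y > x),
    which is symmetric in x and y. Here every term carries in addition a
    permutation of the three tensor factors of H; all of them are expressed by
    the transposition s = (12) and the cyclic shift c = [cyc3], and the same
    computation goes through thanks to s^2 = 1, c^3 = 1 and s c = c^2 s.
    Cocommutativity makes s and c descend to the tensor product over H. *)

Set Implicit Arguments.
Unset Strict Implicit.
Unset Printing Implicit Defensive.

Import GRing.Theory.
Local Open Scope ring_scope.

(** Turns the additivity lemmas into the compatibility with subtraction that the [isZmodMorphism]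
    instances below ask for. *)
Lemma morphD_zmod (U V : zmodType) (f : U -> V) :
  {morph f : x y / x + y} -> zmod_morphism f.
Proof.
by move=> fD x y; apply: (addIr (f y)); rewrite -fD !subrK.
Qed.

(** * Permutations of tensor factors *)

Section TensorPermutations.
Variable k : fieldType.

Lemma tensor_swapK (V W : algType k) :
  cancel (@tensor_swap k V W) (@tensor_swap k W V).
Proof.
elim/tensor_ind=> [v w|X Y IH IH']; first by rewrite !tensor_swap_prod.
by rewrite !tensor_swapD IH IH'.
Qed.

Lemma tensor_swap_map (V W V' W' : algType k)
    (f : {linear V -> V'}) (g : {linear W -> W'}) X :
  tensor_swap (tensor_map f g X) = tensor_map g f (tensor_swap X).
Proof.
elim/tensor_ind: X => [v w|X Y IH IH'].
  by rewrite tensor_map_prod !tensor_swap_prod tensor_map_prod.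
by rewrite !(tensor_mapD, tensor_swapD) IH IH'.
Qed.

Lemma tensor_ind3 (U V W : algType k) (P : tensor (tensor U V) W -> Prop) :
  (forall u v w, P (u ⊗ v ⊗ w)) -> (forall X Y, P X -> P Y -> P (X + Y)) ->
  forall X, P X.
Proof.
move=> Pp PD; elim/tensor_ind=> [X w|]; last exact: PD.
by elim/tensor_ind: X => // X Y; rewrite tprodDl; apply: PD.
Qed.

(** The swap moves the last factor past the block of the first two; [tensor_assoc] then restores the
    left bracketing. *)
Definition cyc3 (U V W : algType k) (X : tensor (tensor U V) W) :
  tensor (tensor W U) V := tensor_assoc (tensor_swap X).

Section Cyc3.
Variables U V W : algType k.

Lemma cyc3_prod (u : U) (v : V) (w : W) : cyc3 (u ⊗ v ⊗ w) = w ⊗ u ⊗ v.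
Proof. by rewrite /cyc3 tensor_swap_prod tensor_assoc_prod. Qed.

Lemma cyc3D : {morph @cyc3 U V W : X Y / X + Y}.
Proof. by move=> X Y; rewrite /cyc3 tensor_swapD tensor_assocD. Qed.

Lemma cyc3M : {morph @cyc3 U V W : X Y / X * Y}.
Proof. by move=> X Y; rewrite /cyc3 tensor_swapM tensor_assocM. Qed.

End Cyc3.

Lemma cyc3K (U V W : algType k) (X : tensor (tensor U V) W) : cyc3 (cyc3 (cyc3 X)) = X.
Proof.
elim/tensor_ind3: X => [u v w|X Y IH IH']; first by rewrite !cyc3_prod.
by rewrite !cyc3D IH IH'.
Qed.

End TensorPermutations.

(** * Permutations of [H3] and the coproduct *)

Section Pseudoalgebra.
Variables (k : fieldType) (H : cocommHopfAlgType k).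
Local Notation H2 := (tensor H H).
Local Notation H3 := (tensor (tensor H H) H).

Lemma swap12_prod (a b c : H) : swap12 (a ⊗ b ⊗ c) = b ⊗ a ⊗ c.
Proof. by rewrite /swap12 tensor_map_prod /= tensor_swap_prod. Qed.

Lemma swap12_tprodl (F : H2) (c : H) : swap12 (F ⊗ c) = tensor_swap F ⊗ c.
Proof. exact: tensor_map_prod. Qed.

Lemma swap12D : {morph @swap12 k H : X Y / X + Y}.
Proof. exact: tensor_mapD. Qed.

Lemma swap12_mul : {morph @swap12 k H : X Y / X * Y}.
Proof. exact: tensor_mapM. Qed.

Lemma swap12K : involutive (@swap12 k H).
Proof.
elim/tensor_ind3=> [a b c|X Y IH IH']; first by rewrite !swap12_prod.
by rewrite !swap12D IH IH'.
Qed.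

Lemma swap12_cyc3 (X : H3) : swap12 (cyc3 X) = cyc3 (cyc3 (swap12 X)).
Proof.
elim/tensor_ind3: X => [a b c|X Y IH IH'].
  by rewrite !(cyc3_prod, swap12_prod).
by rewrite !(cyc3D, swap12D) IH IH'.
Qed.

(** [swap12] after [cyc3] is the transposition (23), which leaves the first factor alone. *)
Lemma swap12_cyc3_assoc (F : H2) :
  swap12 (cyc3 (tensor_assoc (1 ⊗ F))) = tensor_assoc (1 ⊗ tensor_swap F).
Proof.
elim/tensor_ind: F => [a b|X Y IH IH'].
  by rewrite tensor_swap_prod !tensor_assoc_prod cyc3_prod swap12_prod.
by rewrite !(tensor_swapD, tprodDr, tensor_assocD, cyc3D, swap12D) IH IH'.
Qed.

Lemma id_comul_swap (F : H2) : id_comul (tensor_swap F) = cyc3 (comul_id F).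
Proof. by rewrite /cyc3 /comul_id tensor_swap_map. Qed.

(** By [id_comul_swap] and cocommutativity the shift turns the comultiplication of the first factor
    of [comul h] into that of the second; coassociativity identifies the two. This is what lets
    [cyc3] descend to [ps3]. *)
Lemma cyc3_comul3 (h : H) : cyc3 (comul3 h) = comul3 h.
Proof. by rewrite -[comul3 h]/(comul_id _) -id_comul_swap comulC; apply: comulA. Qed.

Lemma cyc3M_comul3 (X : H3) (h : H) : cyc3 (X * comul3 h) = cyc3 X * comul3 h.
Proof. by rewrite cyc3M cyc3_comul3. Qed.

Lemma swap12_comul_id (F : H2) : swap12 (comul_id F) = comul_id F.
Proof.
elim/tensor_ind: F => [a b|X Y IH IH'].
  by rewrite /comul_id tensor_map_prod swap12_tprodl comulC.
by rewrite /comul_id tensor_mapD swap12D IH IH'.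
Qed.

(** Again (23), now acting on the two factors created by the coproduct. Conjugating by the cyclic
    shift reduces this to [swap12_comul_id]. *)
Lemma swap12_cyc3_id_comul (F : H2) : swap12 (cyc3 (id_comul F)) = id_comul F.
Proof.
rewrite -[F]tensor_swapK id_comul_swap !swap12_cyc3 cyc3K.
by rewrite swap12_comul_id.
Qed.

(** * The induced permutations of [ps2 M] and [ps3 M] *)

Section Modules.
Variable M : lmodType H.

Lemma scale_ps2_prod (F G : H2) (m : M) :
  F *: (ext_prod comul G m : ps2 M) = ext_prod comul (F * G) m.
Proof. exact: scale_ext_prod. Qed.

Lemma scale_ps3_prod (F G : H3) (m : M) :
  F *: (ext_prod (@comul3 k H) G m : ps3 M) = ext_prod (@comul3 k H) (F * G) m.
Proof. exact: scale_ext_prod. Qed.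

Lemma transp2Z (F : H2) (X : ps2 M) : transp2 (F *: X) = tensor_swap F *: transp2 X.
Proof.
elim/ext_ind: X => [G m|X Y IH IH'].
  by rewrite scale_ps2_prod !transp2_prod scale_ps2_prod tensor_swapM.
by rewrite scalerDr !transp2D IH IH' scalerDr.
Qed.

Lemma transp2K : involutive (@transp2 k H M).
Proof.
elim/ext_ind=> [G m|X Y IH IH']; first by rewrite !transp2_prod tensor_swapK.
by rewrite !transp2D IH IH'.
Qed.

Lemma transp3Z (F : H3) (X : ps3 M) : transp3 (F *: X) = swap12 F *: transp3 X.
Proof.
elim/ext_ind: X => [G m|X Y IH IH'].
  by rewrite scale_ps3_prod !transp3_prod scale_ps3_prod swap12_mul.
by rewrite scalerDr !transp3D IH IH' scalerDr.
Qed.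

Definition cyc3_ps (X : ps3 M) : ps3 M := ext_map (@comul3 k H) (@cyc3 k H H H) X.

Lemma cyc3_ps_prod (F : H3) (m : M) :
  cyc3_ps (ext_prod (@comul3 k H) F m) = ext_prod (@comul3 k H) (cyc3 F) m.
Proof. by apply: ext_map_prod; [exact: cyc3D | exact: cyc3M_comul3]. Qed.

Lemma cyc3_psD : {morph cyc3_ps : X Y / X + Y}.
Proof. by apply: ext_mapD; [exact: cyc3D | exact: cyc3M_comul3]. Qed.

Lemma cyc3_psZ (F : H3) (X : ps3 M) : cyc3_ps (F *: X) = cyc3 F *: cyc3_ps X.
Proof.
elim/ext_ind: X => [G m|X Y IH IH'].
  by rewrite scale_ps3_prod !cyc3_ps_prod scale_ps3_prod cyc3M.
by rewrite scalerDr !cyc3_psD IH IH' scalerDr.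
Qed.

Lemma cyc3_psK (X : ps3 M) : cyc3_ps (cyc3_ps (cyc3_ps X)) = X.
Proof.
elim/ext_ind: X => [G m|X Y IH IH']; first by rewrite !cyc3_ps_prod cyc3K.
by rewrite !cyc3_psD IH IH'.
Qed.

Lemma transp3K : involutive (@transp3 k H M).
Proof.
elim/ext_ind=> [G m|X Y IH IH']; first by rewrite !transp3_prod swap12K.
by rewrite !transp3D IH IH'.
Qed.

Lemma transp3_cyc3 (X : ps3 M) :
  transp3 (cyc3_ps X) = cyc3_ps (cyc3_ps (transp3 X)).
Proof.
elim/ext_ind: X => [G m|X Y IH IH'].
  by rewrite !(cyc3_ps_prod, transp3_prod) swap12_cyc3.
by rewrite !(cyc3_psD, transp3D) IH IH'.
Qed.

Lemma transp3_comul_id_ps (X : ps2 M) :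
  transp3 (comul_id_ps X) = comul_id_ps X.
Proof.
elim/ext_ind: X => [G m|X Y IH IH'].
  by rewrite !comul_id_ps_prod transp3_prod swap12_comul_id.
by rewrite !comul_id_psD transp3D IH IH'.
Qed.

Lemma transp3_cyc3_id_comul_ps (X : ps2 M) :
  transp3 (cyc3_ps (id_comul_ps X)) = id_comul_ps X.
Proof.
elim/ext_ind: X => [G m|X Y IH IH'].
  by rewrite !id_comul_ps_prod cyc3_ps_prod transp3_prod swap12_cyc3_id_comul.
by rewrite !id_comul_psD cyc3_psD transp3D IH IH'.
Qed.

Lemma id_comul_ps_transp2 (X : ps2 M) :
  id_comul_ps (transp2 X) = cyc3_ps (comul_id_ps X).
Proof.
elim/ext_ind: X => [G m|X Y IH IH'].
  rewrite transp2_prod id_comul_ps_prod id_comul_swap.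
  by rewrite comul_id_ps_prod cyc3_ps_prod.
by rewrite transp2D id_comul_psD IH IH' comul_id_psD cyc3_psD.
Qed.

End Modules.

HB.instance Definition _ (M : lmodType H) := GRing.isZmodMorphism.Build
  (ps2 M) (ps2 M) (@transp2 k H M) (morphD_zmod (@transp2D k H M)).
HB.instance Definition _ (M : lmodType H) := GRing.isZmodMorphism.Build
  (ps3 M) (ps3 M) (@transp3 k H M) (morphD_zmod (@transp3D k H M)).
HB.instance Definition _ (M : lmodType H) := GRing.isZmodMorphism.Build
  (ps3 M) (ps3 M) (@cyc3_ps M) (morphD_zmod (@cyc3_psD M)).
HB.instance Definition _ (M : lmodType H) := GRing.isZmodMorphism.Build
  (ps2 M) (ps3 M) (@comul_id_ps k H M) (morphD_zmod (@comul_id_psD k H M)).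
HB.instance Definition _ (M : lmodType H) := GRing.isZmodMorphism.Build
  (ps2 M) (ps3 M) (@id_comul_ps k H M) (morphD_zmod (@id_comul_psD k H M)).

Lemma transp3N (M : lmodType H) (X : ps3 M) : transp3 (- X) = - transp3 X.
Proof. exact: raddfN. Qed.

Lemma cyc3_psN (M : lmodType H) (X : ps3 M) : cyc3_ps (- X) = - cyc3_ps X.
Proof. exact: raddfN. Qed.

(** * Compositions with transposed arguments and flipped operations *)

Section Operations.
Variables L M N : lmodType H.
Implicit Types op : L -> M -> ps2 N.

Definition op_flip op (y : M) (x : L) : ps2 N := transp2 (op x y).

Definition op_sub op op' (x : L) (y : M) : ps2 N := op x y - op' x y.

Lemma op_flip_bilinear op : pseudo_bilinear op -> pseudo_bilinear (op_flip op).
Proof.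
case=> Dl Dr Zl Zr opM; rewrite /op_flip; split=> *.
- by rewrite Dr raddfD.
- by rewrite Dl raddfD.
(* The swap is linear and unital, hence fixes the scalars [c%:A]. *)
- by rewrite Zr transp2Z linearZ rmorph1.
- by rewrite Zl transp2Z linearZ rmorph1.
- by rewrite opM transp2Z tensor_swap_prod.
Qed.

Lemma op_sub_bilinear op op' :
  pseudo_bilinear op -> pseudo_bilinear op' -> pseudo_bilinear (op_sub op op').
Proof.
case=> Dl Dr Zl Zr opM [Dl' Dr' Zl' Zr' opM']; rewrite /op_sub; split=> *.
- by rewrite Dl Dl' opprD addrACA.
- by rewrite Dr Dr' opprD addrACA.
- by rewrite Zl Zl' scalerBr.
- by rewrite Zr Zr' scalerBr.
- by rewrite opM opM' scalerBr.
Qed.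

Section Composition.
Variable op : L -> M -> ps2 N.
Hypothesis op_bil : pseudo_bilinear op.

Lemma comp_lB X X' y : comp_l op (X - X') y = comp_l op X y - comp_l op X' y.
Proof.
apply: (morphD_zmod (f := fun X => comp_l op X y)) => X1 X2 /=.
exact: (comp_lD op_bil).
Qed.

Lemma comp_rB x Y Y' : comp_r op x (Y - Y') = comp_r op x Y - comp_r op x Y'.
Proof. by apply: morphD_zmod => Y1 Y2; exact: (comp_rD op_bil). Qed.

(** The transposition acts on the coefficient [F ⊗ 1] through [F] alone, and it fixes [comul_id_ps]
    by cocommutativity. *)
Lemma comp_l_transp2 X y : comp_l op (transp2 X) y = transp3 (comp_l op X y).
Proof.
elim/ext_ind: X => [F x|X Y IH IH'].
  by rewrite transp2_prod !comp_l_prod // transp3Z swap12_tprodl transp3_comul_id_ps.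
by rewrite transp2D !comp_lD // raddfD IH IH'.
Qed.

(** Here the two factors of [Y] occupy places 2 and 3, so the permutation is (23), written as
    [transp3] after [cyc3_ps]. *)
Lemma comp_r_transp2 x Y :
  comp_r op x (transp2 Y) = transp3 (cyc3_ps (comp_r op x Y)).
Proof.
elim/ext_ind: Y => [F y|X Y IH IH'].
  rewrite transp2_prod !comp_r_prod // cyc3_psZ transp3Z swap12_cyc3_assoc.
  by rewrite transp3_cyc3_id_comul_ps.
by rewrite transp2D !comp_rD // !raddfD IH IH'.
Qed.

(** The factor belonging to [y] passes from the last place to the first, in front of the two factors
    of [X]: a cyclic shift. *)
Lemma comp_r_flip y X : comp_r (op_flip op) y X = cyc3_ps (comp_l op X y).
Proof.
have fop_bil := op_flip_bilinear op_bil.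
elim/ext_ind: X => [F x|X Y IH IH'].
  rewrite comp_r_prod // comp_l_prod // cyc3_psZ id_comul_ps_transp2.
  by rewrite /cyc3 tensor_swap_prod.
by rewrite comp_lD // comp_rD // raddfD IH IH'.
Qed.

Lemma comp_l_sub op' X y : pseudo_bilinear op' ->
  comp_l (op_sub op op') X y = comp_l op X y - comp_l op' X y.
Proof.
move=> op'_bil; have sop_bil := op_sub_bilinear op_bil op'_bil.
elim/ext_ind: X => [F x|X Y IH IH'].
  by rewrite !comp_l_prod // raddfB scalerBr.
by rewrite !comp_lD // IH IH' opprD addrACA.
Qed.

Lemma comp_r_sub op' x Y : pseudo_bilinear op' ->
  comp_r (op_sub op op') x Y = comp_r op x Y - comp_r op' x Y.
Proof.
move=> op'_bil; have sop_bil := op_sub_bilinear op_bil op'_bil.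
elim/ext_ind: Y => [F y|X Y IH IH'].
  by rewrite !comp_r_prod // raddfB scalerBr.
by rewrite !comp_rD // IH IH' opprD addrACA.
Qed.

End Composition.
End Operations.

Lemma comp_l_flip (L M N : lmodType H) (op : L -> M -> ps2 N) X x :
  pseudo_bilinear op ->
  comp_l (op_flip op) X x = cyc3_ps (cyc3_ps (comp_r op x X)).
Proof.
move=> op_bil; have fop_bil := op_flip_bilinear op_bil.
have ffop_bil := op_flip_bilinear fop_bil.
(* One of the three shifts is absorbed by [comp_r_flip] applied to the flipped operation. The double
   flip agrees with [op] pointwise, so the two sides are then compared on generators. *)
rewrite -[LHS]cyc3_psK -comp_r_flip //; congr (cyc3_ps (cyc3_ps _)).
elim/ext_ind: X => [F y|X Y IH IH'].
  by rewrite !comp_r_prod // /op_flip transp2K.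
by rewrite !comp_rD // IH IH'.
Qed.

(** * The associator of the pre-Lie product *)

Section Dendriform.
Variables (A : lmodType H) (prec succ : A -> A -> ps2 A).
Hypothesis A_dendriform : dendriform prec succ.

Definition dendriform_op : A -> A -> ps2 A := op_sub succ (op_flip prec).

Let prec_bil := dendriform_prec A_dendriform.
Let succ_bil := dendriform_succ A_dendriform.
Let flip_bil := op_flip_bilinear prec_bil.

(** Permutations are normalised to a power of the shift after at most one [transp3]. The terms are
    grouped in pairs exchanged by [transp3] together with [x <-> y], which makes the symmetry
    visible. *)
Lemma dendriform_op_assoc x y z :
  comp_l dendriform_op (dendriform_op x y) z
    - comp_r dendriform_op x (dendriform_op y z) =
  (cyc3_ps (cyc3_ps (transp3 (comp_r succ x (prec z y))))
     + cyc3_ps (comp_r succ y (prec z x)))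
  - (comp_l succ (prec x y) z + transp3 (comp_l succ (prec y x) z))
  - (cyc3_ps (cyc3_ps (comp_r prec z (succ x y)))
     + cyc3_ps (transp3 (comp_r prec z (succ y x)))).
Proof.
rewrite /dendriform_op comp_l_sub // comp_r_sub // comp_l_flip // comp_r_flip //.
rewrite /op_sub /op_flip !comp_lB // !comp_rB //.
rewrite !comp_l_transp2 // !comp_r_transp2 //.
(* The axioms are used at the triples (y, z, x), (z, y, x) and (x, y, z), the last one from right to
   left. *)
rewrite (dendriform_succ_prec A_dendriform) (dendriform_precA A_dendriform).
rewrite -(dendriform_succA A_dendriform) comp_lD // comp_rD //.
rewrite !(raddfD, raddfB) /= !cyc3_psN !transp3_cyc3 !cyc3_psK.
(* Of the ten terms, 1 and 6 are the opposite copies of [comp_l succ (succ x y) z], and 4 and 9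
   those of the shifted transpose of [comp_r prec z (prec y x)]; the other six follow in the order
   of the statement. *)
rewrite !opprK !addrA [LHS](ACl (1*6*(4*9)*7*8*5*2*3*10)) /=.
by rewrite !subrr !add0r.
Qed.

End Dendriform.
End Pseudoalgebra.

Unset Implicit Arguments.

Theorem proposition2p10 (k : closedFieldType) (k_char0 : [pchar k] =i pred0)
    (H : cocommHopfAlgType k) (A : lmodType H) (prec succ : A -> A -> ps2 A)
    (A_dendriform : dendriform prec succ) :
  pre_lie (fun x y => succ x y - transp2 (prec y x)).
Proof.
rewrite -[fun x y => _]/(dendriform_op prec succ).
split=> [|x y z].
  apply: op_sub_bilinear; first exact: dendriform_succ A_dendriform.
  exact/op_flip_bilinear/(dendriform_prec A_dendriform).
rewrite !(dendriform_op_assoc A_dendriform) !(raddfD, raddfB) /=.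
rewrite !transp3N !transp3_cyc3 !transp3K !cyc3_psK.
(* Each of the three pairs now appears on the right with its two terms interchanged. *)
by congr (_ + _ + _); apply: addrC.
Qed.
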